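(* Let $\alpha\in(0,1]$ and let $\mathbf E=(E^S_t)$ be a future-extension coherent dynamic intersection $e$-process collection. Then the closure process $\mathfrak R_\alpha(\mathbf E)=(\mathfrak R_{\alpha,t}(\mathbf E))_{t\ge 0}$ controls simultaneous stopped FDR at level $\alpha$: for every $P\in\mathcal M$ and every $(\mathcal F_t)$-stopping time $\tau$ with $P(\tau<\infty)=1$, $$\mathbb E_P\Big[\max_{R\in\mathfrak R_{\alpha,\tau}(\mathbf E)}\mathrm{FDP}_{\mathcal N(P)}(R)\Big]\le\alpha .$$ Consequently, any $\mathcal F_\tau$-measurable selection $\widehat R\in\mathfrak R_{\alpha,\tau}(\mathbf E)$ from the candidate family at $\tau$ satisfies $\mathbb E_P[\mathrm{FDP}_{\mathcal N(P)}(\widehat R)]\le\alpha$.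
   Context: Let $(\Omega,\mathcal F,(\mathcal F_t)_{t\in\mathbb N_0})$ be a discrete-time filtered measurable space, $\mathcal M$ a family of probability measures on $(\Omega,\mathcal F)$, $\mathcal I\subseteq\mathbb N$ an index set (finite or infinite), and $H_i\subseteq\mathcal M$, $i\in\mathcal I$, null hypotheses. Put $\mathcal N(P)=\{i\in\mathcal I:P\in H_i\}$ and, for finite $S\subseteq\mathcal I$, $H_S=\bigcap_{i\in S}H_i$ (with $H_\varnothing=\mathcal M$). The active sets $I_t\subseteq\mathcal I$ are deterministic and finite with $I_0\subseteq I_1\subseteq\cdots$ and $\bigcup_t I_t=\mathcal I$. For a finite $R\subseteq\mathcal I$ and any $S\subseteq\mathcal I$, $\mathrm{FDP}_S(R)=|S\cap R|/(|R|\vee 1)$. A nonnegative $(\mathcal F_t)$-adapted process $E=(E_t)_{t\ge0}$ is an $e$-process for $H\subseteq\mathcal M$ if $\mathbb E_P[E_\tau]\le1$ for every $P\in H$ and every $(\mathcal F_t)$-stopping time $\tau$ with $P(\tau<\infty)=1$. A dynamic intersection $e$-process collection is a family $\mathbf E=(E^S_t)_{t\ge0,\ S\subseteq\mathcal I,\ 0<|S|<\infty}$ such that $E^S=(E^S_t)_{t\ge0}$ is an $e$-process for $H_S$ for each nonempty finite $S$. It is future-extension coherent if, pointwise on $\Omega$, $E_t^{S\cap I_t}\le E_t^S$ for every $t$ and every finite $S$ with $S\cap I_t\ne\varnothing$. The closure family at time $t$ is $\mathfrak R_{\alpha,t}(\mathbf E)=\{R\subseteq I_t:\ \mathrm{FDP}_S(R)\le\alpha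 E^S_t\text{ for every nonempty }S\subseteq I_t\}$. *)

(* Defs.v *)
From HB Require Import structures.
From mathcomp Require Import all_boot all_order all_algebra finmap.
From mathcomp Require Import all_classical all_reals all_analysis measurable_realfun.

Set Implicit Arguments.
Unset Strict Implicit.
Unset Printing Implicit Defensive.

Import Order.TTheory GRing.Theory Num.Theory.

Local Open Scope classical_set_scope.
Local Open Scope ring_scope.

(* A random time [tau : T -> option nat] takes values in N together with
   infinity, the latter being encoded by [None]. *)

Definition time_le T (tau : T -> option nat) (t : nat) : set T :=
  [set w | if tau w is Some s then (s <= t)%N else False].

Definition time_finite T (tau : T -> option nat) : set T :=
  [set w | tau w != None].

(* Value of the process [X] at time [tau]; [x0] is a conventional value on the
   event that [tau] is infinite, which is null whenever this is used. *)
Definition stopped T V (x0 : V) (X : nat -> T -> V) (tau : T -> option nat)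
    (w : T) : V :=
  if tau w is Some t then X t w else x0.

Section Filtrations.
Context d (T : measurableType d).

Record filtration (F : nat -> set (set T)) : Prop := {
  filtration_sigma_algebra : forall t, sigma_algebra setT (F t);
  filtration_measurable : forall t, F t `<=` @measurable d T;
  filtration_mono : forall s t, (s <= t)%N -> F s `<=` F t }.

Definition adapted (R : realType) (F : nat -> set (set T))
    (X : nat -> T -> \bar R) : Prop :=
  forall t (B : set (\bar R)), measurable B -> F t (X t @^-1` B).

Definition stopping_time (F : nat -> set (set T)) (tau : T -> option nat)
    : Prop :=
  forall t, F t (time_le tau t).

Definition stopped_sigma_algebra (F : nat -> set (set T))
    (tau : T -> option nat) : set (set T) :=
  [set A | measurable A /\ forall t, F t (A `&` time_le tau t)].

End Filtrations.

Section Hypotheses.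
Context d (T : measurableType d) (R : realType).

Definition true_nulls (I : set nat) (H : nat -> set (probability T R))
    (P : probability T R) : set nat :=
  [set i | I i /\ H i P].

Definition intersection_null (M : set (probability T R))
    (H : nat -> set (probability T R)) (S : {fset nat})
    : set (probability T R) :=
  [set P | M P /\ forall i, i \in S -> H i P].

Definition FDP (S : set nat) (A : {fset nat}) : R :=
  #|` [fset i in A | i \in S]%fset|%:R / (maxn #|` A| 1)%:R.

(* [+oo] is an admissible value; real-valued processes are a special case. *)
Record e_process (F : nat -> set (set T)) (H : set (probability T R))
    (X : nat -> T -> \bar R) : Prop := {
  e_process_ge0 : forall t w, (0 <= X t w)%E;
  e_process_adapted : adapted F X;
  e_process_le1 : forall P tau, H P -> stopping_time F tau ->
    P (time_finite tau) = 1%E ->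
    (\int[P]_w stopped 0%E X tau w <= 1)%E }.

(* Only the values [E S] at nonempty finite [S] included in [I] matter. *)
Definition intersection_e_process_collection (F : nat -> set (set T))
    (M : set (probability T R)) (I : set nat)
    (H : nat -> set (probability T R))
    (E : {fset nat} -> nat -> T -> \bar R) : Prop :=
  forall S : {fset nat}, [set` S] `<=` I -> S != fset0 ->
    e_process F (intersection_null M H S) (E S).

End Hypotheses.

Record active_sets (I : set nat) (It : nat -> {fset nat}) : Prop := {
  active_sets_mono : forall s t, (s <= t)%N -> fsubset (It s) (It t);
  active_sets_cover : \bigcup_t [set` It t] = I }.

Definition future_extension_coherent T (R : realType) (I : set nat)
    (It : nat -> {fset nat}) (E : {fset nat} -> nat -> T -> \bar R) : Prop :=
  forall t (S : {fset nat}) w, [set` S] `<=` I -> fsetI S (It t) != fset0 ->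
    (E (fsetI S (It t)) t w <= E S t w)%E.

Definition closure_family T (R : realType) (alpha : R)
    (It : nat -> {fset nat}) (E : {fset nat} -> nat -> T -> \bar R)
    (t : nat) (w : T) : set {fset nat} :=
  [set A | fsubset A (It t) /\
    forall S : {fset nat}, S != fset0 -> fsubset S (It t) ->
      ((FDP R [set` S] A)%:E <= alpha%:E * E S t w)%E].

Lemma closure_family_fset0 T (R : realType) (alpha : R)
    (It : nat -> {fset nat}) (E : {fset nat} -> nat -> T -> \bar R) t w :
  0 <= alpha ->
  (forall S : {fset nat}, S != fset0 -> fsubset S (It t) -> (0 <= E S t w)%E) ->
  closure_family alpha It E t w fset0.
Proof.
move=> a0 E0; split=> [|S S0 SI]; first exact: fsub0set.
have -> : FDP R [set` S] fset0 = 0.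
  rewrite /FDP (_ : [fset i in fset0 | _]%fset = fset0) ?cardfs0 ?mul0r//.
  by apply/fsetP => i; rewrite !inE.
by rewrite mule_ge0 ?lee_fin ?E0.
Qed.

(* The largest FDP over the candidates in [C t w], a family of subsets of
   [It t]. The base value [0] does not affect this maximum: FDPs are
   nonnegative, and for closure families the range is nonempty by
   [closure_family_fset0]. *)
Definition max_FDP T (R : realType) (It : nat -> {fset nat})
    (C : nat -> T -> set {fset nat}) (S : set nat) (t : nat) (w : T) : R :=
  \big[Order.max/0]_(A <- fpowerset (It t) | A \in C t w) FDP R S A.

Definition controls_simultaneous_stopped_FDR d (T : measurableType d)
    (R : realType) (F : nat -> set (set T)) (M : set (probability T R))
    (I : set nat) (H : nat -> set (probability T R)) (It : nat -> {fset nat})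
    (alpha : R) (C : nat -> T -> set {fset nat}) : Prop :=
  forall P tau, M P -> stopping_time F tau -> P (time_finite tau) = 1%E ->
    ('E_P[stopped 0%R (max_FDP R It C (true_nulls I H P)) tau] <= alpha%:E)%E.

(* Selections take values in the countable set of finite subsets of [nat],
   equipped with its discrete sigma-algebra. *)
Definition measurable_selection d (T : measurableType d)
    (F : nat -> set (set T)) (C : nat -> T -> set {fset nat})
    (tau : T -> option nat) (Rhat : T -> {fset nat}) : Prop :=
  (forall U : set {fset nat}, stopped_sigma_algebra F tau (Rhat @^-1` U)) /\
  (forall w t, tau w = Some t -> C t w (Rhat w)).

(* Main.v *)
Require Import Defs.
From mathcomp Require Import all_boot all_order all_algebra finmap.
From mathcomp Require Import all_classical all_reals all_analysis measurable_realfun.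
From mathcomp Require Import lra.
Import Order.TTheory GRing.Theory Num.Theory.
Local Open Scope classical_set_scope.
Local Open Scope ring_scope.

(** Fix a law [P] and let [N] be the set of its true nulls.  A candidate [A]
    at time [t] lies in [It t], so its FDP with respect to [N] only sees the
    finite set [N_t] of true nulls active at time [t], and membership in the
    closure family bounds it by [alpha * E N_t t].  The difficulty is that
    [N_t] moves with [t], so no single e-process bounds the stopped FDP; and
    when [N] is infinite there is no e-process for [N] itself.

    Future-extension coherence removes the moving index up to any horizon [n]:
    for [t <= n] the set [N_t] is the intersection of [N_n] with [It t], hence
    [E N_t t <= E N_n t], and [E N_n] is one e-process, valid under [P] because
    [P] lies in every hypothesis of [N_n] ([closure_family_FDP_le]).  So on the
    event that [tau <= n] the stopped FDP is at most [alpha] times [E N_n]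
    stopped at [tau], and elsewhere it is at most 1.  Integrating, its
    expectation is at most [alpha + P(tau > n)]; letting [n] grow finishes the
    proof, as [tau] is almost surely finite ([expectation_le_of_time_le]).

    The bound is pointwise in the candidate, so the maximum over the closure
    family and a measurable selection from it are two instances of the same
    estimate ([closure_family_expectation_le]). *)

(** * Monotonicity of the integral *)

(** The integral of a nonnegative function is the supremum of the integrals of
    the simple functions below it, and this set of simple functions grows with
    the function.  It lets an arbitrary function be compared with a measurable
    bound on it. *)
Lemma ge0_le_integral_nonmeasurable (d : measure_display)
    (T : measurableType d) (R : realType) (mu : {measure set T -> \bar R})
    (f g : T -> \bar R) :
  (forall w, 0 <= f w)%E -> (forall w, f w <= g w)%E ->
  (\int[mu]_w f w <= \int[mu]_w g w)%E.
Proof.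
move=> f0 fg.
have g0 w : (0 <= g w)%E := le_trans (f0 w) (fg w).
rewrite !ge0_integralTE//; apply: le_ereal_sup => _ [h /= hf <-].
by exists h => // w; exact: le_trans (hf w) (fg w).
Qed.

(** * False discovery proportions *)

Section FDP.
Context (R : realType).
Implicit Types (S : set nat) (A : {fset nat}).

Lemma FDP_ge0 S A : 0 <= FDP R S A.
Proof. by rewrite /FDP divr_ge0. Qed.

Lemma FDP_le1 S A : FDP R S A <= 1.
Proof.
rewrite /FDP ler_pdivrMr ?ltr0n ?leq_max ?orbT// mul1r ler_nat leq_max.
apply/orP; left; apply: fsubset_leq_card.
by apply/fsubsetP => i; rewrite !inE => /andP[].
Qed.

Lemma eq_FDP_in S S' A : (forall i, i \in A -> S i <-> S' i) ->
  FDP R S A = FDP R S' A.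
Proof.
move=> SS'; rewrite /FDP; congr (#|` _|%:R / _).
apply/fsetP => i; rewrite !inE; case iA : (i \in A) => //=.
by apply/idP/idP; rewrite !inE => /(SS' i iA).
Qed.

Lemma FDP_disjoint S A : (forall i, i \in A -> ~ S i) -> FDP R S A = 0.
Proof.
move=> SA; rewrite /FDP (_ : [fset i in A | _]%fset = fset0) ?cardfs0 ?mul0r//.
apply/fsetP => i; rewrite !inE; apply/negP => /andP[iA].
by rewrite inE => /(SA i iA).
Qed.

End FDP.

(** * Stopping at a random time *)

Section Stopping.
Context {d : measure_display} {T : measurableType d} {R : realType}.
Context {F : nat -> set (set T)} {tau : T -> option nat}.
Hypotheses (hF : filtration F) (htau : stopping_time F tau).

Lemma measurable_time_le n : measurable (time_le tau n).
Proof. exact: filtration_measurable hF _ _ (htau n). Qed.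

Lemma bigcup_time_le : \bigcup_n time_le tau n = time_finite tau.
Proof.
apply/seteqP; split=> w; rewrite /time_le /time_finite /=.
  by case=> n _ /=; case: (tau w).
by case E: (tau w) => [t|]// _; exists t => //=; rewrite E.
Qed.

(** Continuity from below, the events [tau <= n] increasing to [tau] finite. *)
Lemma cvg_time_le (P : probability T R) : P (time_finite tau) = 1%E ->
  (P (time_le tau n) @[n --> \oo] --> 1)%E.
Proof.
move=> <-; rewrite -bigcup_time_le.
apply: nondecreasing_cvg_mu; first exact: measurable_time_le.
  by apply: bigcupT_measurable; exact: measurable_time_le.
move=> m n mn; apply/subsetPset => w; rewrite /time_le /=.
by case: (tau w) => // t /leq_trans; apply.
Qed.

Lemma measurable_time_eq o : measurable [set w | tau w = o].
Proof.
case: o => [t|]; last first.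
  have -> : [set w | tau w = None] = ~` time_finite tau.
    apply/seteqP; split=> w; rewrite /time_finite /=; first by move=> ->.
    by move/negP; rewrite negbK => /eqP.
  rewrite -bigcup_time_le; apply: measurableC.
  by apply: bigcupT_measurable; exact: measurable_time_le.
have -> : [set w | tau w = Some t] =
    time_le tau t `\` \bigcup_(s < t) time_le tau s.
  apply/seteqP; split=> w; rewrite /time_le /=.
    move=> E; rewrite E; split=> //= -[s /= st]; rewrite E.
    by rewrite leqNgt st.
  case E: (tau w) => [s|] /= [] // st nlt; congr Some.
  apply/eqP; rewrite eqn_leq st leqNgt; apply/negP => lt_st.
  by apply: nlt; exists s => //=; rewrite E.
apply: measurableD; first exact: measurable_time_le.
by apply: bigcup_measurable => s _; exact: measurable_time_le.
Qed.

(** There are countably many values of [tau]; on each of them the stopped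
    process is one of the [X t], or the constant [x0]. *)
Lemma measurable_stopped (x0 : \bar R) (X : nat -> T -> \bar R) :
  adapted F X -> measurable_fun setT (stopped x0 X tau).
Proof.
move=> aX _ B mB; rewrite setTI.
have -> : stopped x0 X tau @^-1` B =
    (\bigcup_t ([set w | tau w = Some t] `&` X t @^-1` B)) `|`
    ([set w | tau w = None] `&` cst x0 @^-1` B).
  apply/seteqP; split=> w; rewrite /stopped /preimage /=.
    by case E: (tau w) => [t|] h; [left; exists t|right].
  by case=> [[t _ [/= -> ]]|[/= ->]].
apply: measurableU.
  apply: bigcupT_measurable => t; apply: measurableI.
    exact: measurable_time_eq.
  exact: filtration_measurable hF _ _ (aX t B mB).
apply: measurableI; first exact: measurable_time_eq.
by rewrite -[_ @^-1` _]setTI; exact: measurable_cst.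
Qed.

(** Before the horizon [n] the bound [alpha * Y n] is available, and after it
    [X <= 1]; hence the expectation is at most [alpha + P(tau > n)] for every
    [n].  Letting [Y] depend on [n] is what allows a different e-process at
    each horizon. *)
Lemma expectation_le_of_time_le (P : probability T R) (alpha : R)
    (X : T -> R) (Y : nat -> T -> \bar R) :
  P (time_finite tau) = 1%E -> 0 <= alpha ->
  (forall w, 0 <= X w <= 1) ->
  (forall n w, 0 <= Y n w)%E ->
  (forall n, measurable_fun setT (Y n)) ->
  (forall n, \int[P]_w Y n w <= 1)%E ->
  (forall n w, time_le tau n w -> (X w)%:E <= alpha%:E * Y n w)%E ->
  ('E_P[X] <= alpha%:E)%E.
Proof.
move=> tauP alpha0 X01 Y0 mY Y1 XY.
have X0 w : (0 <= (X w)%:E)%E by rewrite lee_fin; case/andP: (X01 w).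
rewrite unlock.
have step n : (\int[P]_w (X w)%:E <= alpha%:E + (1 - P (time_le tau n)))%E.
  have mA := measurable_time_le n.
  apply: (@le_trans _ _
    (\int[P]_w (alpha%:E * Y n w + (\1_(~` time_le tau n) w)%:E))%E).
    apply: ge0_le_integral_nonmeasurable => // w.
    have [wn|wn] := pselect (time_le tau n w).
      by apply: (le_trans (XY _ _ wn)); rewrite leeDl// lee_fin.
    rewrite indicE mem_set//= (@le_trans _ _ 1%E) ?leeDr ?mule_ge0 ?lee_fin//.
    by case/andP: (X01 w).
  rewrite ge0_integralD//=; last 3 first.
  - by move=> w _; rewrite mule_ge0.
  - exact: measurable_funeM.
  - by apply/measurable_EFinP; apply: measurable_indic; exact: measurableC.
  rewrite ge0_integralZl_EFin// integral_indic ?setIT; [|by []|exact: measurableC].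
  rewrite -(probability_setC P mA) leeD2r//.
  by rewrite -[leRHS]mule1 lee_wpmul2l.
have IX0 : (0 <= \int[P]_w (X w)%:E)%E by exact: integral_ge0.
have {}step n :
    (\int[P]_w (X w)%:E <= (alpha + (1 - fine (P (time_le tau n))))%:E)%E.
  rewrite EFinD EFinB fineK ?step//.
  exact: fin_num_measure (measurable_time_le n).
move: IX0 step; case: (\int[P]_w (X w)%:E)%E => [x x0 step|_ /(_ 0%N)|] //.
(* Isolating [P (tau <= n)] makes it the only term that depends on [n], so
   that the limit needs no arithmetic on convergent sequences. *)
have Pn n : (P (time_le tau n) <= (alpha + 1 - x)%:E)%E.
  rewrite -[leLHS]fineK; last exact: fin_num_measure (measurable_time_le n).
  by have := step n; rewrite !lee_fin => h; lra.
have : (1 <= (alpha + 1 - x)%:E)%E.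
  rewrite -(cvg_lim _ (cvg_time_le P tauP))//.
  by apply: lime_le; [apply/cvg_ex; exists 1%E; exact: cvg_time_le|exact: nearW].
by rewrite !lee_fin => h; lra.
Qed.

End Stopping.

(** * The closure family and coherence *)

Definition active_part (It : nat -> {fset nat}) (N : set nat) (t : nat)
    : {fset nat} :=
  [fset i in It t | i \in N]%fset.

Lemma active_partP {It N t i} : (i \in active_part It N t) <-> i \in It t /\ N i.
Proof.
by rewrite !inE /=; split=> [/andP[-> /set_mem]//|[-> /mem_set ->]].
Qed.

Section Closure.
Context {T : Type} {R : realType} {I : set nat} {It : nat -> {fset nat}}.
Context {E : {fset nat} -> nat -> T -> \bar R} {alpha : R}.
Hypotheses (hIt : active_sets I It) (alpha0 : 0 <= alpha).
Hypothesis hcoh : future_extension_coherent I It E.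

(** The index of the e-value on the right is the part of [N] active at the
    horizon [n], not at the time [t] of the candidate: this is the step where
    coherence turns the bound that defines the closure family into one by an
    e-process that is the same for all [t <= n].  A zero FDP is a separate case
    because an intersection e-process exists only for nonempty index sets. *)
Lemma closure_family_FDP_le {N n t w A} : N `<=` I -> (t <= n)%N ->
  closure_family alpha It E t w A ->
  FDP R N A = 0 \/
  active_part It N n != fset0 /\
  ((FDP R N A)%:E <= alpha%:E * E (active_part It N n) t w)%E.
Proof.
move=> NI tn [/fsubsetP AI closA].
have ItS := fsubsetP (active_sets_mono hIt tn).
have [Nt0|Nt0] := eqVneq (active_part It N t) fset0.
  left; apply: FDP_disjoint => i iA Ni.
  have : i \in active_part It N t by apply/active_partP; split=> //; exact: AI.
  by rewrite Nt0 inE.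
(* The relation between [N_t] and [N_n] that coherence speaks about. *)
have NtE : (active_part It N n `&` It t)%fset = active_part It N t.
  apply/fsetP => i; rewrite in_fsetI; apply/andP/idP.
    by case=> /active_partP[_ Ni] it; apply/active_partP.
  move/active_partP=> [it Ni]; split=> //.
  by apply/active_partP; split=> //; exact: ItS.
right; split.
  by apply: contra_neq Nt0 => Nn0; rewrite -NtE Nn0 fset0I.
have -> : FDP R N A = FDP R [set` active_part It N t] A.
  apply: eq_FDP_in => i iA /=; split=> [Ni|/active_partP[]//].
  by apply/active_partP; split=> //; exact: AI.
have sub : fsubset (active_part It N t) (It t).
  by apply/fsubsetP => i /active_partP[].
apply: le_trans (closA _ Nt0 sub) _; apply: lee_wpmul2l => //.
rewrite -NtE; apply: hcoh; rewrite ?NtE// => i /= /active_partP[_].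
exact: NI.
Qed.

End Closure.

(** The common form of both conclusions: [X] is a stopped maximum or the FDP of
    a selection.  The alternative [X w = 0] covers the base value of a maximum,
    and nothing ties [X] to candidates where [tau] is infinite. *)
Lemma closure_family_expectation_le {d : measure_display}
  {T : measurableType d} {R : realType}
  {F : nat -> set (set T)} {M : set (probability T R)} {I : set nat}
  {H : nat -> set (probability T R)} {It : nat -> {fset nat}}
  {E : {fset nat} -> nat -> T -> \bar R} {alpha : R}
  {P : probability T R} {tau : T -> option nat} {X : T -> R} :
  filtration F -> active_sets I It -> 0 <= alpha ->
  intersection_e_process_collection F M I H E ->
  future_extension_coherent I It E ->
  M P -> stopping_time F tau -> P (time_finite tau) = 1%E ->
  (forall w, 0 <= X w <= 1) ->
  (forall w t, tau w = Some t -> X w = 0 \/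
    exists2 A, closure_family alpha It E t w A &
      X w <= FDP R (true_nulls I H P) A) ->
  ('E_P[X] <= alpha%:E)%E.
Proof.
move=> hF hIt alpha0 hE hcoh MP htau tauP X01 XA.
set N := true_nulls I H P in XA.
have NI : N `<=` I by move=> i [].
have SI n : [set` active_part It N n] `<=` I.
  by move=> i /= /active_partP[_ /NI].
(* If no true null is active at the horizon, the FDP vanishes up to it and 0
   replaces the missing e-process. *)
pose Y n := if active_part It N n == fset0 then cst 0%E
            else stopped 0%E (E (active_part It N n)) tau.
apply: (expectation_le_of_time_le hF htau P alpha X Y) => //.
- move=> n w; rewrite /Y; case: ifPn => // Nn0; rewrite /stopped.
  by case: (tau w) => // t; apply: e_process_ge0 (hE _ (SI n) Nn0) _ _.
- move=> n; rewrite /Y; case: ifPn => [_|Nn0]; first exact: measurable_cst.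
  apply: (measurable_stopped hF htau).
  exact: e_process_adapted (hE _ (SI n) Nn0).
- move=> n; rewrite /Y; case: ifPn => [_|Nn0].
    by rewrite integral0.
  apply: (e_process_le1 (hE _ (SI n) Nn0)) => //; split=> // i.
  by move=> /active_partP[_ []].
move=> n w; rewrite /time_le /=; case tauw : (tau w) => [t|//] tn.
have pos : (0 <= alpha%:E * Y n w)%E.
  apply: mule_ge0 => //; rewrite /Y; case: ifPn => // Nn0; rewrite /stopped tauw.
  by apply: e_process_ge0 (hE _ (SI n) Nn0) _ _.
have [->//|[A clA XA']] := XA w t tauw.
apply: (@le_trans _ _ (FDP R N A)%:E); first by rewrite lee_fin.
have [->//|[Nn0]] := closure_family_FDP_le hIt alpha0 hcoh NI tn clA.
by rewrite /Y (negbTE Nn0) /stopped tauw.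
Qed.

Theorem theorem3p6 (d : measure_display) (T : measurableType d) (R : realType)
  (F : nat -> set (set T)) (M : set (probability T R)) (I : set nat)
  (H : nat -> set (probability T R)) (It : nat -> {fset nat})
  (E : {fset nat} -> nat -> T -> \bar R) (alpha : R)
  (hF : filtration F)
  (hH : forall i, I i -> H i `<=` M)
  (hIt : active_sets I It)
  (halpha : 0 < alpha <= 1)
  (hE : intersection_e_process_collection F M I H E)
  (hcoh : future_extension_coherent I It E) :
  controls_simultaneous_stopped_FDR F M I H It alpha
    (closure_family alpha It E) /\
  (forall (P : probability T R) (tau : T -> option nat)
      (Rhat : T -> {fset nat}),
    M P -> stopping_time F tau -> P (time_finite tau) = 1%E ->
    measurable_selection F (closure_family alpha It E) tau Rhat ->
    ('E_P[fun w => FDP R (true_nulls I H P) (Rhat w)] <= alpha%:E)%E).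
Proof.
have alpha0 : 0 <= alpha by case/andP: halpha => /ltW.
split=> [P tau MP htau tauP|P tau Rhat MP htau tauP [_ sel]].
  apply: (closure_family_expectation_le hF hIt alpha0 hE hcoh MP htau tauP).
    move=> w; rewrite /stopped; case: (tau w) => [t|]; last by rewrite lexx ler01.
    rewrite /max_FDP; apply/andP; split.
      exact: bigmax_ge_id.
    by apply: bigmax_le => // A _; exact: FDP_le1.
  move=> w t tauw; rewrite /stopped tauw /max_FDP.
  (* A maximum over a list is its base value 0 or is attained. *)
  apply: (big_ind (fun x => x = 0 \/ exists2 A, closure_family alpha It E t w A
    & x <= FDP R (true_nulls I H P) A)).
  - by left.
  - by move=> x y hx hy; case: (leP x y).
  - by move=> A /set_mem clA; right; exists A.
apply: (closure_family_expectation_le hF hIt alpha0 hE hcoh MP htau tauP).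
  by move=> w; rewrite FDP_ge0 FDP_le1.
by move=> w t tauw; right; exists (Rhat w) => //; exact: sel.
Qed.
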